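(* Let $\lambda$ be a nonzero real number and let $m\ge 1$ and $r\ge 1$ be integers. For every integer $k\ge 0$, as formal power series in $t$, $$\frac{1}{k!}\frac{1}{\lambda^{k}}\bigg(\frac{e^{\lambda mt}-1}{m}\bigg)^{k}e^{rt}=\sum_{n=k}^{\infty}W_{m,\lambda}^{(r)}(n,k)\frac{t^{n}}{n!}.$$
   Context: For a nonzero real $\lambda$, the generalized falling factorials are $(x)_{0,\lambda}=1$ and $(x)_{n,\lambda}=x(x-\lambda)\cdots(x-(n-1)\lambda)$ for $n\ge 1$. For integers $m\ge 1$ and $r\ge 1$, the $\lambda$-analogues of the Whitney-type $r$-Stirling numbers of the second kind $W_{m,\lambda}^{(r)}(n,k)$ ($0\le k\le n$) are the real numbers uniquely determined by the polynomial identities in $x$ $$(mx+r)^{n}=\sum_{k=0}^{n}W_{m,\lambda}^{(r)}(n,k)m^{k}(x)_{k,\lambda},\quad n\ge 0.$$ *)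

(* Defs.v *)
From HB Require Import structures.
From mathcomp Require Import all_boot all_order all_algebra.
From mathcomp Require Import boolp reals.

Set Implicit Arguments.
Unset Strict Implicit.
Unset Printing Implicit Defensive.

Import Order.TTheory GRing.Theory Num.Theory.
Local Open Scope ring_scope.

(* [Fps a] is the formal power series \sum_n a(n) t^n.  The wrapper type keeps
   the Cauchy product apart from the pointwise product of functions nat -> R. *)
Record fps (R : Type) := Fps { fcoef : nat -> R }.

HB.instance Definition _ (R : Type) := [isNew for @fcoef R].
HB.instance Definition _ (R : choiceType) := [Choice of fps R by <:].

Section FpsRing.
Variable R : comNzRingType.
Implicit Types f g h : fps R.

Lemma fpsP f g : (forall n, fcoef f n = fcoef g n) <-> f = g.
Proof.
split=> [fg|-> //]; case: f g fg => [a] [b] /= ab.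
by congr Fps; apply/funext.
Qed.

Definition fps_zero : fps R := Fps (fun=> 0).
Definition fps_opp f : fps R := Fps (fun n => - fcoef f n).
Definition fps_add f g : fps R := Fps (fun n => fcoef f n + fcoef g n).
Definition fps_one : fps R := Fps (fun n => (n == 0%N)%:R).
Definition fps_mul f g : fps R :=
  Fps (fun n => \sum_(i < n.+1) fcoef f i * fcoef g (n - i)).
Definition fps_scale (c : R) f : fps R := Fps (fun n => c * fcoef f n).

Fact fps_addA : associative fps_add.
Proof. by move=> f g h; apply/fpsP=> n /=; rewrite addrA. Qed.

Fact fps_addC : commutative fps_add.
Proof. by move=> f g; apply/fpsP=> n /=; rewrite addrC. Qed.

Fact fps_add0 : left_id fps_zero fps_add.
Proof. by move=> f; apply/fpsP=> n /=; rewrite add0r. Qed.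

Fact fps_addN : left_inverse fps_zero fps_opp fps_add.
Proof. by move=> f; apply/fpsP=> n /=; rewrite addNr. Qed.

HB.instance Definition _ :=
  GRing.isZmodule.Build (fps R) fps_addA fps_addC fps_add0 fps_addN.

Fact fps_mulC : commutative fps_mul.
Proof.
move=> f g; apply/fpsP=> n /=; rewrite (reindex_inj rev_ord_inj) /=.
by apply: eq_bigr => i _; rewrite mulrC subSS subKn // -ltnS.
Qed.

(* Up to any order, a series agrees with a polynomial. *)
Let trunc n f : {poly R} := \poly_(i < n.+1) fcoef f i.

Let coef_trunc n f i : (i <= n)%N -> (trunc n f)`_i = fcoef f i.
Proof. by move=> lein; rewrite coef_poly ltnS lein. Qed.

Let coef_trunc_mul n f g i : (i <= n)%N ->
  (trunc n f * trunc n g)`_i = fcoef (fps_mul f g) i.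
Proof.
move=> lein; rewrite coefM /=; apply: eq_bigr => j _.
rewrite !coef_trunc ?(leq_trans (leq_subr _ _)) //.
by rewrite (leq_trans _ lein) // -ltnS.
Qed.

Fact fps_mulA : associative fps_mul.
Proof.
move=> f g h; apply/fpsP=> n.
transitivity ((trunc n f * (trunc n g * trunc n h))`_n).
  rewrite coefM /=; apply: eq_bigr => i _.
  by rewrite coef_trunc -1?ltnS // coef_trunc_mul // leq_subr.
rewrite mulrA coefM /=; apply: eq_bigr => i _.
by rewrite coef_trunc_mul -1?ltnS // coef_trunc // leq_subr.
Qed.

Fact fps_mul1 : left_id fps_one fps_mul.
Proof.
move=> f; apply/fpsP=> n /=; rewrite big_ord_recl /= mul1r subn0.
by rewrite big1 ?addr0 // => i _; rewrite mul0r.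
Qed.

Fact fps_mulDl : left_distributive fps_mul fps_add.
Proof.
move=> f g h; apply/fpsP=> n /=; rewrite -big_split /=.
by apply: eq_bigr => i _; rewrite mulrDl.
Qed.

Fact fps_one_neq0 : fps_one != 0.
Proof.
apply/eqP=> /(congr1 (fun f => fcoef f 0)) /= /eqP.
by rewrite oner_eq0.
Qed.

HB.instance Definition _ := GRing.Zmodule_isComNzRing.Build (fps R)
  fps_mulA fps_mulC fps_mul1 fps_mulDl fps_one_neq0.

Fact fps_scaleA c d f : fps_scale c (fps_scale d f) = fps_scale (c * d) f.
Proof. by apply/fpsP=> n /=; rewrite mulrA. Qed.

Fact fps_scale1 : left_id 1 fps_scale.
Proof. by move=> f; apply/fpsP=> n /=; rewrite mul1r. Qed.

Fact fps_scaleDr : right_distributive fps_scale +%R.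
Proof. by move=> c f g; apply/fpsP=> n /=; rewrite mulrDr. Qed.

Fact fps_scaleDl f : {morph fps_scale^~ f : c d / c + d}.
Proof. by move=> c d; apply/fpsP=> n /=; rewrite mulrDl. Qed.

HB.instance Definition _ := GRing.Zmodule_isLmodule.Build R (fps R)
  fps_scaleA fps_scale1 fps_scaleDr fps_scaleDl.

Fact fps_scaleAl c f g : c *: (f * g) = (c *: f) * g.
Proof.
by apply/fpsP=> n /=; rewrite mulr_sumr; apply: eq_bigr => i _; rewrite mulrA.
Qed.

HB.instance Definition _ := GRing.Lmodule_isLalgebra.Build R (fps R) fps_scaleAl.

End FpsRing.

(* e^(a t) *)
Definition fps_exp (R : fieldType) (a : R) : fps R :=
  Fps (fun n => a ^+ n / n`!%:R).

(* (x)_(n, lambda) as a polynomial in the indeterminate x = 'X *)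
Definition gfalling (R : comNzRingType) (lambda : R) (n : nat) : {poly R} :=
  \prod_(i < n) ('X - (i%:R * lambda)%:P).

(* The defining identities of W_(m,lambda)^(r)(n, k); the values W n k with
   n < k are left unconstrained. *)
Definition whitney_stirling2 (R : comNzRingType) (lambda : R) (m r : nat)
    (W : nat -> nat -> R) : Prop :=
  forall n : nat,
    (m%:R *: 'X + r%:R%:P) ^+ n =
    \sum_(k < n.+1) (W n k * m%:R ^+ k) *: gfalling lambda k.

Section WellDefined.
Variable R : realType.
Implicit Types (lambda : R) (m r n k : nat) (c d : nat -> R).

Lemma gfallingS lambda n :
  gfalling lambda n.+1 = gfalling lambda n * ('X - (n%:R * lambda)%:P).
Proof. by rewrite /gfalling big_ord_recr. Qed.

Lemma gfalling_monic lambda n : gfalling lambda n \is monic.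
Proof. by apply: monic_prod => i _; apply: monicXsubC. Qed.

Lemma size_gfalling lambda n : size (gfalling lambda n) = n.+1.
Proof.
elim: n => [|n IHn]; first by rewrite /gfalling big_ord0 size_poly1.
by rewrite gfallingS size_Mmonic ?monic_neq0 ?gfalling_monic ?monicXsubC // IHn
           size_XsubC addn2.
Qed.

Lemma size_gfalling_sum lambda c n :
  (size (\sum_(k < n) c k *: gfalling lambda k)%R <= n)%N.
Proof.
apply: (leq_trans (size_sum _ _ _)); apply/bigmax_leqP => k _.
by rewrite (leq_trans (size_scale_leq _ _)) // size_gfalling.
Qed.

Lemma gfalling_span lambda n (p : {poly R}) : (size p <= n)%N ->
  exists c, p = \sum_(k < n) c k *: gfalling lambda k.
Proof.
elim: n p => [|n IHn] p lepn.
  by exists (fun=> 0); rewrite big_ord0; apply/eqP; rewrite -size_poly_leq0.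
have [|c pE] := IHn (p - p`_n *: gfalling lambda n).
  apply/leq_sizeP => j lenj; rewrite coefB coefZ.
  move: lenj; rewrite leq_eqVlt => /predU1P [<-|ltnj].
    have := monicP (gfalling_monic lambda n).
    by rewrite lead_coefE size_gfalling => ->; rewrite mulr1 subrr.
  rewrite (nth_default _ (leq_trans lepn ltnj)) [X in _ * X]nth_default.
    by rewrite mulr0 subrr.
  by rewrite size_gfalling.
exists (fun k => if k == n then p`_n else c k).
rewrite big_ord_recr /= eqxx -[LHS](subrK (p`_n *: gfalling lambda n)) pE.
by congr (_ + _); apply: eq_bigr => k _; rewrite ltn_eqF.
Qed.

Lemma gfalling_free lambda n c d :
  \sum_(k < n) c k *: gfalling lambda k =
  \sum_(k < n) d k *: gfalling lambda k ->
  forall k, (k < n)%N -> c k = d k.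
Proof.
elim: n => [|n IHn] // cdE k; rewrite !big_ord_recr /= in cdE.
have cdn : c n = d n.
  have := congr1 (fun p : {poly R} => p`_n) cdE.
  rewrite !coefD !(nth_default _ (size_gfalling_sum _ _ _)) !add0r !coefZ.
  have := monicP (gfalling_monic lambda n).
  by rewrite lead_coefE size_gfalling => ->; rewrite !mulr1.
move: cdE; rewrite cdn => /addIr cdE.
by rewrite ltnS leq_eqVlt => /predU1P [-> //|]; apply: IHn.
Qed.

Lemma whitney_stirling2_exists lambda m r : (0 < m)%N ->
  exists W, whitney_stirling2 lambda m r W.
Proof.
move=> m_gt0; have m_neq0 : m%:R != 0 :> R by rewrite pnatr_eq0 -lt0n.
have sz n : (size ((m%:R *: 'X + r%:R%:P) ^+ n : {poly R})%R <= n.+1)%N.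
  apply: (leq_trans (size_poly_exp_leq _ _)); rewrite ltnS.
  rewrite -[X in (_ <= X)%N]mul1n leq_mul2r; apply/orP; right.
  have : (size (m%:R *: 'X + r%:R%:P : {poly R})%R <= 2)%N.
    apply: (leq_trans (size_polyD _ _)); rewrite geq_max.
    rewrite (leq_trans (size_scale_leq _ _)) ?size_polyX //.
    by rewrite (leq_trans (size_polyC_leq1 _)).
  by case: (size _).
have /choice [C CE] n := gfalling_span lambda (sz n).
exists (fun n k => C n k / m%:R ^+ k) => n; rewrite {1}CE.
by apply: eq_bigr => k _; rewrite divfK // expf_neq0.
Qed.

Lemma whitney_stirling2_unique lambda m r W V : (0 < m)%N ->
  whitney_stirling2 lambda m r W -> whitney_stirling2 lambda m r V ->
  forall n k, (k <= n)%N -> W n k = V n k.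
Proof.
move=> m_gt0 WE VE n k lekn.
have m_neq0 : m%:R != 0 :> R by rewrite pnatr_eq0 -lt0n.
have := etrans (esym (WE n)) (VE n).
move=> /(gfalling_free (c := fun k => W n k * m%:R ^+ k)
                       (d := fun k => V n k * m%:R ^+ k)) /(_ k lekn).
by apply: mulIf; rewrite expf_neq0.
Qed.

End WellDefined.

(* Main.v *)
From HB Require Import structures.
Require Import Defs.
From mathcomp Require Import all_boot all_order all_algebra.
From mathcomp Require Import reals.
From mathcomp Require Import ring.
Import GRing.Theory Num.Theory.
Local Open Scope ring_scope.

(** Evaluate the defining identity at [x = j * lambda], where the generalized
    falling factorial [(x)_(i, lambda)] becomes [lambda ^ i * i! * 'C(j, i)].
    The left-hand side [(m j lambda + r) ^ n] is [n!] times the coefficient of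
    [t ^ n] in [e^(r t) * (1 + (e^(lambda m t) - 1)) ^ j], which the binomial
    theorem expands over the same ['C(j, i)].  Binomial transforms are
    injective, so the coefficients of ['C(j, i)] agree for [i <= n]; for
    [k > n] the left-hand series has order at least [k]. *)

(** The system is triangular with diagonal ['C(j, j) = 1]: strong induction cancels the terms below
    [j]. *)
Lemma binomial_transform_inj (R : pzRingType) (n : nat) (a b : nat -> R) :
  (forall j, (j <= n)%N ->
    \sum_(i < j.+1) a i *+ 'C(j, i) = \sum_(i < j.+1) b i *+ 'C(j, i)) ->
  forall j, (j <= n)%N -> a j = b j.
Proof.
move=> ab j; elim/ltn_ind: j => j IHj lejn.
have := ab j lejn; rewrite !big_ord_recr /= binn !mulr1n.
rewrite (eq_bigr (fun i : 'I_j => b i *+ 'C(j, i))); first by move/addrI.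
by move=> i _; rewrite IHj // (leq_trans (ltnW (ltn_ord i))).
Qed.

(** The factors become [(j - l) * lambda] for [l < i], and their product is [lambda ^+ i] times
    [j ^_ i], which vanishes for [i > j]. *)
Lemma gfalling_horner (R : comNzRingType) (lambda : R) (j i : nat) :
  (gfalling lambda i).[j%:R * lambda] = (lambda ^+ i * i`!%:R) *+ 'C(j, i).
Proof.
rewrite -mulrnAr -mulrnA mulnC bin_ffact.
elim: i => [|i IHi]; first by rewrite /gfalling big_ord0 hornerC mul1r.
rewrite /gfalling big_ord_recr hornerM IHi hornerXsubC ffactnSr natrM -mulrBl exprSr.
have [leij|ltji] := leqP i j; first by rewrite natrB //; ring.
by rewrite ffact_small // !(mul0r, mulr0).
Qed.

(** Allows [exprZn] to pull the scalar [m%:R^-1] out of the [k]-th power. *)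
HB.instance Definition _ (R : comNzRingType) :=
  GRing.Lalgebra_isComAlgebra.Build R (fps R).

Lemma fcoef_sum (R : comNzRingType) (I : Type) (s : seq I) (F : I -> fps R) n :
  fcoef (\sum_(i <- s) F i) n = \sum_(i <- s) fcoef (F i) n.
Proof. by elim/big_rec2: _ => // i x f _ <-. Qed.

Lemma fcoefMn (R : comNzRingType) (f : fps R) c n :
  fcoef (f *+ c) n = fcoef f n *+ c.
Proof. by elim: c => // c IHc; rewrite !mulrS -IHc. Qed.

(** Each factor [f] raises the order by at least one: peeling it off leaves only coefficients of
    index below [n]. *)
Lemma fcoef_mulX_small (R : comNzRingType) (f g : fps R) k n :
  fcoef f 0 = 0 -> (n < k)%N -> fcoef (f ^+ k * g) n = 0.
Proof.
move=> f0; elim: k n => // k IHk n ltnk.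
rewrite exprS -mulrA /= big_ord_recl f0 mul0r add0r big1 // => i _.
rewrite -/(fps_mul _ _) [X in _ * X]IHk ?mulr0 //=.
by rewrite /bump; have := ltn_ord i; case: n ltnk i => [|n] ltnk i // _;
   rewrite add1n subSS (leq_ltn_trans (leq_subr _ _)).
Qed.

(** The binomial theorem divided by [n!], since ['C(n, i) / n! = 1 / (i! (n - i)!)]. *)
Lemma fps_expD (R : numFieldType) (a b : R) :
  fps_exp (a + b) = fps_exp a * fps_exp b.
Proof.
have fact_neq0 l : l`!%:R != 0 :> R by rewrite pnatr_eq0 -lt0n fact_gt0.
apply/fpsP => n /=; rewrite addrC exprDn mulr_suml; apply: eq_bigr => i _.
have lein : (i <= n)%N by rewrite -ltnS.
rewrite -(bin_fact lein) !natrM -mulr_natr.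
have bin_neq0 : 'C(n, i)%:R != 0 :> R by rewrite pnatr_eq0 -lt0n bin_gt0.
by field; rewrite bin_neq0 !fact_neq0.
Qed.

Lemma fps_expMn (R : numFieldType) (a : R) j :
  fps_exp (a *+ j) = fps_exp a ^+ j.
Proof.
elim: j => [|j IHj]; last by rewrite mulrS exprS fps_expD IHj.
apply/fpsP => n /=; rewrite mulr0n expr0n.
by case: n => [|n]; rewrite ?divr1 ?mul0r.
Qed.

Lemma fps_exp_binomial (R : numFieldType) (a b : R) j n :
  (a *+ j + b) ^+ n =
  \sum_(i < j.+1)
    (n`!%:R * fcoef ((fps_exp a - 1) ^+ i * fps_exp b) n) *+ 'C(j, i).
Proof.
have fact_neq0 : n`!%:R != 0 :> R by rewrite pnatr_eq0 -lt0n fact_gt0.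
transitivity (n`!%:R * fcoef (fps_exp (a *+ j + b)) n).
  by rewrite /= mulrC divfK.
(* Putting [1] first makes [exprDn] give the exponent [i] to [fps_exp a - 1]. *)
rewrite fps_expD fps_expMn -[fps_exp a in LHS](addrNK 1) addrC exprDn mulr_suml.
rewrite fcoef_sum mulr_sumr; apply: eq_bigr => i _.
by rewrite expr1n mul1r -[RHS]mulrnAr -fcoefMn -[in RHS]mulrnAl.
Qed.

Lemma whitney_stirling2_binomial (R : comNzRingType) (lambda : R) (m r : nat)
    (W : nat -> nat -> R) (n j : nat) :
  whitney_stirling2 lambda m r W -> (j <= n)%N ->
  ((lambda * m%:R) *+ j + r%:R) ^+ n =
  \sum_(i < j.+1) (W n i * m%:R ^+ i * (lambda ^+ i * i`!%:R)) *+ 'C(j, i).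
Proof.
move=> WE lejn; have /(congr1 (horner^~ (j%:R * lambda))) := WE n.
rewrite horner_exp hornerD hornerZ hornerX hornerC horner_sum.
have -> : m%:R * (j%:R * lambda) = (lambda * m%:R) *+ j by ring.
(* The defining identity sums up to [n]; its terms with [j < i] vanish because ['C(j, i) = 0]. *)
move=> ->; rewrite [RHS](big_ord_widen n.+1
  (fun i => (W n i * m%:R ^+ i * (lambda ^+ i * i`!%:R)) *+ 'C(j, i))) //.
rewrite [RHS]big_mkcond; apply: eq_bigr => i _.
rewrite hornerZ gfalling_horner.
by case: ltnP => [_|ltji]; [rewrite -[RHS]mulrnAr | rewrite bin_small // mulr0n mulr0].
Qed.

Theorem theorem12 (R : realType) (lambda : R) (m r : nat)
    (W : nat -> nat -> R) (k : nat) :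
  lambda != 0 -> (1 <= m)%N -> (1 <= r)%N ->
  whitney_stirling2 lambda m r W ->
  (1 / k`!%:R * (1 / lambda ^+ k)) *:
    ((m%:R^-1 *: (fps_exp (lambda * m%:R) - 1)) ^+ k * fps_exp r%:R) =
  Fps (fun n => if (k <= n)%N then W n k / n`!%:R else 0).
Proof.
move=> lambda_neq0 m_gt0 _ WE.
have m_neq0 : m%:R != 0 :> R by rewrite pnatr_eq0 -lt0n.
have fact_neq0 l : l`!%:R != 0 :> R by rewrite pnatr_eq0 -lt0n fact_gt0.
rewrite exprZn -scalerAl scalerA; apply/fpsP => n.
transitivity ((1 / k`!%:R * (1 / lambda ^+ k) * m%:R^-1 ^+ k) *
  fcoef ((fps_exp (lambda * m%:R) - 1) ^+ k * fps_exp r%:R) n) => //.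
rewrite [RHS]/=; case: leqP => [lekn|ltnk]; last first.
  by rewrite fcoef_mulX_small ?mulr0 //= expr0 divr1 subrr.
have cE : W n k * m%:R ^+ k * (lambda ^+ k * k`!%:R) =
    n`!%:R * fcoef ((fps_exp (lambda * m%:R) - 1) ^+ k * fps_exp r%:R) n.
  apply: (binomial_transform_inj _ n
    (fun i => W n i * m%:R ^+ i * (lambda ^+ i * i`!%:R))
    (fun i => n`!%:R *
       fcoef ((fps_exp (lambda * m%:R) - 1) ^+ i * fps_exp r%:R) n)) => //.
  move=> j lejn.
  by rewrite -fps_exp_binomial (whitney_stirling2_binomial _ _ _ _ _ _ _ WE).
(* Multiplying by [n!] exposes the right side of [cE]; the prefactor then cancels everything but
   [W n k]. *)
apply: (mulfI (fact_neq0 n)); rewrite mulrCA -cE exprVn.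
by field; rewrite !fact_neq0 !expf_neq0.
Qed.
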